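(* Let $n\ge 2$, let $\sigma\in S_n$ be a nontrivial permutation, and let $S=\mathscr M(S_n,2,2,C)$ be the Rees matrix semigroup over the symmetric group $S_n$ with sandwich matrix $C=\begin{bmatrix}1&1\\1&\sigma\end{bmatrix}$. Then the minimal degree of a faithful action of $S$ by either partial or total functions is $2n-|\mathrm{Fix}(\sigma)|$, except when $n=6$ and $\sigma$ is a derangement that is either a $6$-cycle, a product of two disjoint $3$-cycles, or a product of three disjoint $2$-cycles. In these exceptional cases the minimal degree is $11$, $9$ and $8$ respectively.
   Context: For a group $G$, finite sets $A,B$ and a matrix $C\colon B\times A\to G$, the Rees matrix semigroup $\mathscr M(G,A,B,C)$ is the set $A\times G\times B$ with product $(a,g,b)(a',g',b')=(a,gC_{ba'}g',b')$; here $A=B=\{1,2\}$. $\mathrm{Fix}(\sigma)$ is the set of fixed points of $\sigma$ in $\{1,\dots,n\}$. The minimal degree of a faithful action by partial (resp. total) functions is the least $m$ such that $S$ embeds in the monoid of partial (resp. total) maps of an $m$-element set acting on the right. *)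

(* Defs.v *)
From mathcomp Require Import all_boot all_order all_fingroup.
Set Implicit Arguments. Unset Strict Implicit. Unset Printing Implicit Defensive.

Local Open Scope group_scope.

(* The Rees matrix semigroup M(S_n, {1,2}, {1,2}, C) with
   C = [[1,1],[1,sigma]].  Indices 1,2 are encoded as ord0, ord_max : 'I_2. *)
Definition rees_T (n : nat) : finType := ('I_2 * 'S_n * 'I_2)%type.

Definition sandwich (n : nat) (sigma : 'S_n) (b a : 'I_2) : 'S_n :=
  if (b == ord_max) && (a == ord_max) then sigma else 1.

Definition rees_mul (n : nat) (sigma : 'S_n) (x y : rees_T n) : rees_T n :=
  let: (a, g, b) := x in
  let: (a', g', b') := y in
  (a, g * sandwich sigma b a' * g', b').

(* Partial maps on an m-element set acting on the right: x (f g) = (x f) g. *)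
Definition pt_comp (m : nat) (f g : {ffun 'I_m -> option 'I_m}) :
  {ffun 'I_m -> option 'I_m} := [ffun x => obind g (f x)].

Definition t_comp (m : nat) (f g : {ffun 'I_m -> 'I_m}) :
  {ffun 'I_m -> 'I_m} := [ffun x => g (f x)].

Definition faithful_partial (T : Type) (mul : T -> T -> T) (m : nat) : Prop :=
  exists phi : T -> {ffun 'I_m -> option 'I_m},
    injective phi /\ forall x y, phi (mul x y) = pt_comp (phi x) (phi y).

Definition faithful_total (T : Type) (mul : T -> T -> T) (m : nat) : Prop :=
  exists phi : T -> {ffun 'I_m -> 'I_m},
    injective phi /\ forall x y, phi (mul x y) = t_comp (phi x) (phi y).

Definition min_degree_partial (T : Type) (mul : T -> T -> T) (d : nat) : Prop :=
  faithful_partial mul d /\ forall m, faithful_partial mul m -> d <= m.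

Definition min_degree_total (T : Type) (mul : T -> T -> T) (d : nat) : Prop :=
  faithful_total mul d /\ forall m, faithful_total mul m -> d <= m.

Definition Fix (n : nat) (sigma : 'S_n) : {set 'I_n} := [set i | sigma i == i].

(* all cycles of sigma (including trivial ones) have length k *)
Definition all_cycles_of_length (n : nat) (sigma : 'S_n) (k : nat) : bool :=
  [forall X in porbits sigma, #|X| == k].

(* Main.v *)
(* In an action of S on X by partial maps, the idempotent (1,1,1) has an image Y
   on which S_n acts faithfully, and (1,1,2) sends the points of Y moved by sigma
   injectively outside Y; conversely, adjoining to a faithful S_n-set Y a second
   copy of the points moved by sigma gives a faithful total action of S.  So the
   minimal degree is the least value of |Y| + |moved_Y(sigma)| over the faithful
   S_n-sets Y, and |Y| >= n always holds.

   For n >= 7 and |Y| < 2n, a point stabiliser H has index < 2n, hence contains a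
   3-cycle by Bochert's argument.  The relation "some 3-cycle of H moves both i
   and j" is an H-invariant equivalence, and counting cosets yields a class with
   at least n - 1 points, so H contains A_n or fixes a point of {1..n}.  The
   latter happens for some H, so sigma moves at least as many points of Y as of
   {1..n}.  For n <= 6, comparing the orders and parities of sigma on {1..n} and
   on Y leaves only the three exceptional types, which are realised by the action
   of S_6 on the six one-factorizations of K_6. *)
Require Import Defs.
From mathcomp Require Import all_boot all_order all_fingroup.
From mathcomp Require Import zify.
Set Implicit Arguments. Unset Strict Implicit. Unset Printing Implicit Defensive.

Local Open Scope group_scope.

Definition moved (T : finType) (s : {perm T}) : {set T} := [set x | s x != x].

(** Products compose from left to right, so on distinct points this is [i -> j -> k -> i]. *)
Definition cyc3 (T : finType) (i j k : T) : {perm T} := tperm i j * tperm i k.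

(** * Subgroups of small index *)

Section ThreeCycles.

Variable T : finType.
Implicit Types (i j k : T) (s x y : {perm T}).

Lemma cyc3E i j k z : uniq [:: i; j; k] ->
  cyc3 i j k z = if z == i then j else if z == j then k else
                 if z == k then i else z.
Proof.
rewrite /= !inE !negb_or !andbT => /andP[/andP[ij ik] jk]; rewrite permM.
have [->|zi] := eqVneq z i; first by rewrite tpermL tpermD // 1?eq_sym.
have [->|zj] := eqVneq z j; first by rewrite tpermR tpermL.
rewrite eq_sym in zi; rewrite eq_sym in zj; rewrite (@tpermD _ i j) //.
have [->|zk] := eqVneq z k; first by rewrite tpermR.
by rewrite tpermD // eq_sym.
Qed.

Lemma cyc3J i j k s : cyc3 i j k ^ s = cyc3 (s i) (s j) (s k).
Proof. by rewrite conjMg !tpermJ. Qed.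

Lemma cyc3V i j k : uniq [:: i; j; k] -> (cyc3 i j k)^-1 = cyc3 j i k.
Proof.
rewrite /= !inE !negb_or !andbT => /andP[/andP[ij ik] jk].
by rewrite invMg !tpermV conjgC tpermJ tpermL tpermD // /cyc3 (tpermC j i).
Qed.

Lemma cyc3_rot i j k : uniq [:: i; j; k] -> cyc3 i j k = cyc3 j k i.
Proof.
rewrite /= !inE !negb_or !andbT => /andP[/andP[ij ik] jk].
have kj : k != j by rewrite eq_sym.
have ki : k != i by rewrite eq_sym.
have ji : j != i by rewrite eq_sym.
rewrite /cyc3 conjgC tpermJ tpermL (tpermD ij kj) conjgC tpermJ tpermL.
by rewrite (tpermD ki ji) (tpermC k j) (tpermC i j).
Qed.

(** Away from [d] at most one of [x] and [y] moves a given point, so following a point through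
    [x^-1 y^-1 x y] brings it back unless it is [d], [y d] or [x d]. *)
Lemma commg_cyc3 x y d : x d != d -> y d != d ->
  (forall z, x z != z -> y z != z -> z = d) ->
  uniq [:: d; y d; x d] /\ [~ x, y] = cyc3 d (y d) (x d).
Proof.
move=> xd yd xyd.
have xfix z : z != d -> y z != z -> x z = z.
  by move=> zd yz; apply/eqP; apply: contraNT zd => xz; apply/eqP/xyd.
have yfix z : z != d -> x z != z -> y z = z.
  by move=> zd xz; apply/eqP; apply: contraNT zd => yz; apply/eqP/xyd.
have mv (s : {perm T}) z : s z != z -> s (s z) != s z by rewrite (inj_eq perm_inj).
have mvV (s : {perm T}) z : s z != z -> s (s^-1 z) != s^-1 z.
  by rewrite permKV; apply: contraNneq => {1}->; rewrite permKV.
have Vd (s : {perm T}) z : s d != z -> s^-1 z != d.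
  by apply: contraNneq => <-; rewrite permKV.
have fixV (s : {perm T}) z : s z = z -> s^-1 z = z.
  by move=> {1}<-; rewrite permK.
have xyd' : x (y d) = y d by rewrite xfix ?mv.
have yxd' : y (x d) = x d by rewrite yfix ?mv.
have yx : y d != x d by apply: contraNneq (mv x _ xd) => <-; rewrite xyd'.
have U : uniq [:: d; y d; x d].
  by rewrite /= !inE negb_or (eq_sym d) yd (eq_sym d) xd yx.
have xV z : y d != z -> y z != z -> x (y^-1 z) = y^-1 z.
  by move=> dz yz; apply: xfix (Vd _ _ dz) (mvV _ _ yz).
have yV z : x d != z -> x z != z -> y (x^-1 z) = x^-1 z.
  by move=> dz xz; apply: yfix (Vd _ _ dz) (mvV _ _ xz).
split=> //; apply/permP=> z; rewrite cyc3E // !permM.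
have [->|zd] := eqVneq z d; first by rewrite (fixV y) ?permKV ?yV.
have [->|zy] := eqVneq z (y d); first by rewrite (fixV x) // permK.
have [->|zx] := eqVneq z (x d); first by rewrite permK xV ?permKV.
rewrite eq_sym in zx; rewrite eq_sym in zy.
have [xz|xz] := eqVneq (x z) z; last first.
  by rewrite (fixV y) ?permKV ?yV // yfix.
rewrite (fixV x) //; have [yz|yz] := eqVneq (y z) z.
  by rewrite (fixV y) // xz.
by rewrite xV // permKV.
Qed.

End ThreeCycles.

Lemma leq_card_index (gT : finGroupType) (H : {group gT}) (I : finType)
    (D : {set I}) (f : I -> gT) :
  {in D &, forall c d, f c * (f d)^-1 \in H -> c = d} ->
  #|D| <= #|[set: gT] : H|.
Proof.
move=> injf; rewrite -(card_in_imset (f := fun d => H :* f d) (D := D)).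
  apply/subset_leq_card/subsetP=> _ /imsetP[d _ ->].
  by rewrite mem_rcosets mulSGid ?subsetT ?inE.
move=> c d Dc Dd /rcoset_eqP; rewrite mem_rcoset; exact: injf.
Qed.

Lemma perm_imset_eq (T : finType) (A B : {set T}) :
  #|A| = #|B| -> exists s : {perm T}, s @: A = B.
Proof.
have [m] := ubnP #|A :\: B|; elim: m A => // m IH A /ltnSE lem eqAB.
have [|/subsetPn[x Ax nBx]] := boolP (A \subset B).
  move=> sAB; exists 1; rewrite (eq_imset (g := id)) ?imset_id => [|z].
    by apply/eqP; rewrite eqEcard sAB eqAB /=.
  by rewrite perm1.
have [|y By nAy] := subsetPn (_ : ~~ (B \subset A)).
  apply: contra nBx => sBA; suff -> : B = A by [].
  by apply/eqP; rewrite eqEcard sBA eqAB /=.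
(* Swapping a point of [A] outside [B] with a point of [B] outside [A] lowers [#|A :\: B|]. *)
have [||s sB] := IH (tperm x y @: A).
- apply: leq_trans lem; rewrite [X in _ <= X](cardsD1 x) !inE Ax nBx add1n ltnS.
  apply/subset_leq_card/subsetP=> _ /setDP[/imsetP[z Az ->]] nBz.
  rewrite !inE; case: (tpermP x y z) nBz Az => [|-> |/eqP -> _ -> ->] //.
    by rewrite By.
  by rewrite (negPf nAy).
- by rewrite card_imset //; apply: perm_inj.
exists (tperm x y * s); rewrite -sB -imset_comp.
by apply: eq_imset => z; rewrite /= permM.
Qed.

Section SmallIndex.

Variables (T : finType) (H : {group {perm T}}).

(* Bochert's argument: if a base of minimal size exceeds half of the points,
   two elements of H have supports meeting in a single point. *)
Lemma index_lt_fact_cyc3 :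
  #|[set: {perm T}] : H| < (uphalf #|T|)`! ->
  exists i j k, uniq [:: i; j; k] /\ cyc3 i j k \in H.
Proof.
move=> ltH; pose base (D : {set T}) :=
  [forall x in H, perm_on (~: D) x ==> (x == 1)].
have baseT : base setT.
  apply/forall_inP=> x _; apply/implyP=> xT; apply/eqP/permP=> z.
  by rewrite perm1 (out_perm xT) // !inE.
have nbase (D : {set T}) : ~~ base D ->
  exists x, [/\ x \in H, perm_on (~: D) x & x != 1].
  by case/forall_inPn=> x Hx; rewrite negb_imply => /andP[? ?]; exists x.
case: (arg_minnP (fun D : {set T} => #|D|) baseT) => D baseD minD.
(* A base of at most half the points is impossible: the permutations supported off [D] would lie in
   distinct cosets of [H], and they number at least the factorial of [uphalf #|T|]. *)
have [leD|gtD] := leqP #|D|.*2 #|T|.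
  have leK : #|[set x | perm_on (~: D) x]| <= #|[set: {perm T}] : H|.
    apply: (leq_card_index (f := id)) => x y; rewrite !inE => xD yD Hxy.
    apply/eqP; rewrite eq_mulgV1; move/forall_inP: baseD => /(_ _ Hxy).
    by move/implyP; apply; apply: perm_onM (perm_onV yD).
  move: (leq_ltn_trans leK ltH); rewrite cardsE card_perm ltnNge => /negP[].
  by apply: leq_fact; have := cardsC D; lia.
have [x [Hx xD x1]] : exists x, [/\ x \in H, perm_on D x & x != 1].
  rewrite -(setCK D); apply: nbase; apply/negP=> /minD.
  by have := cardsC D; lia.
have [d xd] : exists d, x d != d.
  apply/existsP; apply: contraNT x1; rewrite negb_exists => /forallP fx.
  by apply/eqP/permP=> z; rewrite perm1; apply/eqP; move: (fx z); rewrite negbK.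
have Dd : d \in D by apply: contraNT xd => /(out_perm xD) ->.
(* [D :\ d] is too small to be a base. The resulting [y] fixes the points of [D] other than [d], and
   must move [d] because [D] is a base. *)
have [y [Hy yD y1]] : exists y, [/\ y \in H, perm_on (~: (D :\ d)) y & y != 1].
  by apply: nbase; apply/negP=> /minD; rewrite (cardsD1 d D) Dd; lia.
have yd : y d != d.
  apply: contraNneq y1 => yd.
  have /forall_inP/(_ y Hy)/implyP := baseD; apply.
  apply/subsetP=> z /[!inE]; apply: contraNN => Dz.
  have [->|zd] := eqVneq z d; first by rewrite yd.
  by rewrite (out_perm yD) // !inE zd Dz.
have [|U e] := commg_cyc3 xd yd.
  move=> z xz yz; apply/eqP; apply: contraNT yz => zd.
  rewrite (out_perm yD) // !inE zd /= negbK.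
  by apply: contraNT xz => /(out_perm xD) ->.
by exists d, (y d), (x d); split=> //; rewrite -e groupR.
Qed.

Definition cyc3_rel : rel T := [rel i j |
  (i == j) || [exists k, uniq [:: i; j; k] && (cyc3 i j k \in H)]].

Lemma cyc3_relP i j :
  reflect (i = j \/ exists k, uniq [:: i; j; k] /\ cyc3 i j k \in H)
          (cyc3_rel i j).
Proof.
apply: (iffP orP) => [[/eqP->|/existsP[k /andP[U Hk]]]|[->|[k [U Hk]]]].
- by left.
- by right; exists k.
- by left.
- by right; apply/existsP; exists k; rewrite U.
Qed.

Lemma cyc3_rel_sym : symmetric cyc3_rel.
Proof.
suff sub i j : cyc3_rel i j -> cyc3_rel j i by move=> i j; apply/idP/idP=> /sub.
case/cyc3_relP=> [->|[k [U Hk]]]; apply/cyc3_relP; [by left|right].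
exists k; rewrite -cyc3V ?groupV //; split=> //.
by move: U; rewrite /= !inE !negb_or !andbT eq_sym; case: (j == i) => //= /andP[-> ->].
Qed.

Lemma cyc3_rel_trans : transitive cyc3_rel.
Proof.
move=> j i l /cyc3_relP[->//|[c [Uc Hc]]] /cyc3_relP[<-|[d [Ud Hd]]].
  by apply/cyc3_relP; right; exists c.
have [<-|il] := eqVneq i l; first by apply/cyc3_relP; left.
have [lc|lc] := eqVneq l c.
  rewrite cyc3_rel_sym lc; apply/cyc3_relP; right; exists j.
  have Uc' : uniq [:: c; i; j] by rewrite (rot_uniq 2 [:: i; j; c]).
  by rewrite (cyc3_rot Uc').
(* [h] sends [j] to [i] and, as [l] is not [c], fixes [l]; conjugation by it turns a 3-cycle through
   [j] and [l] into one through [i] and [l]. *)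
pose h := (cyc3 i j c)^-1.
have Hh : h \in H by rewrite groupV.
have hj : h j = i by rewrite -[j](_ : cyc3 i j c i = j) ?permK // cyc3E ?eqxx.
have lj : l != j by move: Ud; rewrite /= !inE negb_or eq_sym; case: (l == j).
have hl : h l = l.
  rewrite -{1}[l](_ : cyc3 i j c l = l) ?permK // cyc3E //.
  by rewrite eq_sym (negPf il) (negPf lj) (negPf lc).
apply/cyc3_relP; right; exists (h d).
have -> : [:: i; l; h d] = map h [:: j; l; d] by rewrite /= hj hl.
rewrite (map_inj_uniq perm_inj); split=> //.
by rewrite -hj -hl -cyc3J groupJ.
Qed.

Lemma cyc3_rel_perm h i j : h \in H -> cyc3_rel (h i) (h j) = cyc3_rel i j.
Proof.
have sub g k l : g \in H -> cyc3_rel k l -> cyc3_rel (g k) (g l).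
  move=> Hg /cyc3_relP[->|[c [U Hc]]]; apply/cyc3_relP; [by left|right].
  exists (g c); rewrite -cyc3J groupJ //; split=> //.
  by rewrite -(map_inj_uniq (@perm_inj _ g)) in U.
move=> Hh; apply/idP/idP=> [|]; last exact: sub.
by rewrite -groupV in Hh; move/(sub _ _ _ Hh); rewrite !permK.
Qed.

Lemma cyc3_rel_total : (forall i j, cyc3_rel i j) ->
  forall i j k, uniq [:: i; j; k] -> cyc3 i j k \in H.
Proof.
move=> tot i j k U; move: (U).
rewrite /= !inE !negb_or !andbT => /andP[/andP[ij ik] jk].
have Ur : uniq [:: j; i; k] by rewrite /= !inE !negb_or eq_sym ij ik jk.
have Urr : uniq [:: k; j; i] by rewrite (rot_uniq 2 [:: j; i; k]).
have /cyc3_relP[/eqP|[d [Ud Hd]]] := tot i j; first by rewrite (negPf ij).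
have [<-//|dk] := eqVneq d k.
have /cyc3_relP[/eqP|[e [Ue He]]] := tot k d; first by rewrite eq_sym (negPf dk).
move: (Ue); rewrite /= !inE !negb_or !andbT => /andP[/andP[_ ke] de].
move: (Ud); rewrite /= !inE !negb_or !andbT => /andP[/andP[_ id] jd].
(* [h] takes [k] to [d]. If it fixes [i] and [j], conjugating [cyc3 i j d] by its inverse gives
   [cyc3 i j k]. Otherwise [e] is [i] or [j], and conjugating by [h] gives the inverse of
   [cyc3 i j k]. *)
pose h := cyc3 k d e.
have hk : h k = d by rewrite cyc3E // eqxx.
have hd : h d = e by rewrite cyc3E // eqxx (negPf dk).
have he : h e = k by rewrite cyc3E // eqxx !(eq_sym e) (negPf ke) (negPf de).
have [ei|ei] := eqVneq e i.
  have hj : h j = j by rewrite cyc3E // (negPf jk) (negPf jd) ei eq_sym (negPf ij).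
  rewrite -(cyc3V Ur) groupV -(cyc3_rot Urr).
  have -> : cyc3 k j i = cyc3 i j d ^ h by rewrite cyc3J hj hd -ei he.
  by rewrite groupJ.
have hi : h i = i by rewrite cyc3E // (negPf ik) (negPf id) eq_sym (negPf ei).
have [ej|ej] := eqVneq e j.
  have -> : cyc3 i j k = (cyc3 i j d ^ h)^-1.
    by rewrite cyc3J hi hd -{2}ej he ej -(cyc3V Ur) (cyc3_rot Ur).
  by rewrite groupV groupJ.
have hj : h j = j by rewrite cyc3E // (negPf jk) (negPf jd) eq_sym (negPf ej).
have hV z w : h z = w -> h^-1 w = z by move=> <-; rewrite permK.
by rewrite -(hV _ _ hi) -(hV _ _ hj) -(hV _ _ hk) -cyc3J groupJ // groupV.
Qed.

(* Elements of a common coset of H carry the classes to the same partition, so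
   elements carrying the class of i0 to distinct sets through i0 lie in
   distinct cosets. *)
Lemma cyc3_class_index (i0 : T) :
  'C(#|T|.-1, #|[set j | cyc3_rel i0 j]|.-1) <= #|[set: {perm T}] : H|.
Proof.
set G := [set j | cyc3_rel i0 j].
have Gi : i0 \in G by rewrite inE; apply/cyc3_relP; left.
(* The condition on [C] sits under the existential so that [xchoose] gives a function of every [C];
   elsewhere the witness [1] is arbitrary. *)
have ex (C : {set T}) : exists s : {perm T},
    (i0 \notin C) && (#|C| == #|G|.-1) ==> (s @: G == i0 |: C).
  have [/andP[iC /eqP cC]|_] := boolP (_ && _); last by exists 1.
  have [|s sG] := @perm_imset_eq T G (i0 |: C); last by exists s; rewrite sG eqxx.
  by rewrite cardsU1 iC cC (cardsD1 i0 G) Gi.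
pose f C := xchoose (ex C).
rewrite -(cardsC1 i0) -cards_draws.
have fE (E : {set T}) : E \subset [set~ i0] -> #|E| == #|G|.-1 ->
    i0 \notin E /\ f E @: G = i0 |: E.
  move=> sE cE; have iE : i0 \notin E.
    by apply: contraTN sE => iE; apply/subsetPn; exists i0; rewrite // !inE eqxx.
  split=> //; apply/eqP; have /implyP := xchooseP (ex E).
  by apply; rewrite iE cE.
apply: (leq_card_index (f := f)) => C D.
rewrite !inE => /andP[/fE fC cC] /andP[/fE fD cD] Hh.
have [iC eC] := fC cC; have [iD eD] := fD cD.
set h := _ * _ in Hh.
have /imsetP[a Ga ea] : i0 \in f C @: G by rewrite eC setU11.
have /imsetP[b Gb eb] : i0 \in f D @: G by rewrite eD setU11.
(* [h] takes one point of the class to another, hence preserves the class, so [f C] and [f D] give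
   it the same image. *)
have ha : h a = b by rewrite permM -ea eb permK.
rewrite -(setU1K iC) -(setU1K iD) -eC -eD; congr (_ :\ _).
apply/eqP; rewrite eqEcard !card_imset ?leqnn ?andbT; [|exact: perm_inj..].
apply/subsetP=> _ /imsetP[c Gc ->].
rewrite -[f C c](permKV (f D)) imset_f // -permM -/h inE.
rewrite !inE in Ga Gb Gc; apply: cyc3_rel_trans Gb _.
by rewrite -ha cyc3_rel_perm //; apply: cyc3_rel_trans Gc; rewrite cyc3_rel_sym.
Qed.

End SmallIndex.

(** Induction by Pascal's rule; the boundary case [k + 2 = n] is the symmetry of binomial
    coefficients. *)
Lemma leq_bin2_bin n k : 2 <= k -> k + 2 <= n -> 'C(n, 2) <= 'C(n, k).
Proof.
elim: n k => [|n IH] [|k] // k2 kn.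
have [->|k1] := eqVneq k 1%N; first by [].
have [kn'|kn'] := eqVneq (k + 2) n.
  by rewrite -[X in _ <= X]bin_sub; [rewrite (_ : n.+1 - k.+1 = 2) //|]; lia.
have h1 : 'C(n, 2) <= 'C(n, k.+1) by apply: IH; lia.
have h2 : 'C(n, 2) <= 'C(n, k) by apply: IH; lia.
have h3 : n <= 'C(n, 2) by rewrite bin2; nia.
by rewrite !binS bin1; lia.
Qed.

Lemma small_index_stab (T : finType) (H : {group {perm T}}) :
  7 <= #|T| -> #|[set: {perm T}] : H| < 2 * #|T| ->
  (forall i j k, uniq [:: i; j; k] -> cyc3 i j k \in H) \/
  exists i, forall h, h \in H -> h i = i.
Proof.
move=> T7 ltH.
have [|i [j [k [U Hc]]]] := @index_lt_fact_cyc3 T H.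
  apply: (leq_trans ltH); have : 4 <= uphalf #|T| by lia.
  have : #|T| <= 2 * uphalf #|T| by lia.
  case: (uphalf _) => [|[|[|[|m]]]] //; rewrite 4!factS => h _.
  have := fact_gt0 m; nia.
set G := [set z | cyc3_rel H i z].
have Gi : i \in G by rewrite inE; apply/cyc3_relP; left.
have Gj : j \in G by rewrite inE; apply/cyc3_relP; right; exists k.
have Gk : k \in G.
  rewrite inE cyc3_rel_sym; apply/cyc3_relP; right; exists j.
  have Uk : uniq [:: k; i; j] by rewrite (rot_uniq 2 [:: i; j; k]).
  by rewrite (cyc3_rot Uk).
have ij : i != j by move: U; rewrite /= !inE negb_or; case: (i == j).
have G3 : 2 < #|G|.
  rewrite -[3]/(size [:: i; j; k]) -(card_uniqP U).
  by apply/subset_leq_card/subsetP=> z; rewrite !inE => /or3P[]/eqP->;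
     rewrite -1?[cyc3_rel H i _]in_set.
have relG x y : x \in G -> y \in G -> cyc3_rel H x y.
  by rewrite !inE cyc3_rel_sym; apply: cyc3_rel_trans.
(* If [G] missed two points, then [3 <= #|G| <= #|T| - 2] and the index would be at least
   ['C(#|T| - 1, 2)], which is at least [2 * #|T|] from [#|T| = 7] on. *)
have leG : #|T| <= #|G|.+1.
  rewrite leqNgt; apply/negP=> ltG; have := cyc3_class_index H i.
  have : 'C(#|T|.-1, 2) <= 'C(#|T|.-1, #|G|.-1) by apply: leq_bin2_bin; lia.
  rewrite -/G => h1 h2; have := leq_ltn_trans (leq_trans h1 h2) ltH.
  rewrite bin2; case: #|T| T7 => // n n6 /=.
  have : 4 * n.+1 <= n * n.-1 by nia.
  by lia.
have [GT|[i1 nGi1]] := set_0Vmem (~: G).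
  left; apply: cyc3_rel_total => x y.
  by apply: relG; rewrite -[G]setCK GT setC0 inE.
right; exists i1; have Gz z : z != i1 -> z \in G.
  have /cards1P[w ew] : #|~: G| == 1%N.
    have := cardsC G; have := nGi1; rewrite (cardsD1 i1 (~: G)) => ->; lia.
  move: nGi1; rewrite ew inE => /eqP->; rewrite -[G]setCK ew !inE; exact.
(* If [h] moved [i1], then [h i1] and [h u], for some [u] in [G], would both lie in [G], making [i1]
   equivalent to [u]. *)
move=> h Hh; apply/eqP; apply/negPn/negP=> /Gz Ghi.
have [u Gu hu] : exists2 u, u \in G & h u != i1.
  have [hi|] := eqVneq (h i) i1; last by exists i.
  by exists j; rewrite // -hi (inj_eq perm_inj) eq_sym.
have := relG _ _ Gu; have := relG _ _ Ghi (Gz _ hu).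
rewrite cyc3_rel_perm // => r _; move: nGi1; rewrite !inE.
by case/negP; move: Gu; rewrite inE => /cyc3_rel_trans; apply; rewrite cyc3_rel_sym.
Qed.

(** * Faithful actions of S_n *)

Section FaithfulAction.

Variables (n : nat) (T : finType) (rho : 'S_n -> {perm T}) (A : {set T}).
Hypotheses (rhoM : {morph rho : g h / g * h}) (rhoI : injective rho).
(** [A] is the set acted on; it sits in a larger [T] because a partial action yields permutations of
    a subset of ['I_m], extended by the identity. *)
Hypothesis rhoA : forall g, perm_on A (rho g).

Lemma rho1 : rho 1 = 1.
Proof. by apply: (mulIg (rho 1)); rewrite -rhoM !mul1g. Qed.

Lemma rhoV g : rho g^-1 = (rho g)^-1.
Proof. by apply: (mulIg (rho g)); rewrite -rhoM !mulVg rho1. Qed.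

Lemma rhoX g k : rho (g ^+ k) = rho g ^+ k.
Proof. by elim: k => [|k IH]; rewrite ?rho1 // !expgS rhoM IH. Qed.

Lemma leq_degree_faithful : 1 < n -> n <= #|A|.
Proof.
move=> n1; have : n`! <= #|A|`!.
  rewrite -card_perm -card_Sn -(card_imset _ rhoI).
  by apply/subset_leq_card/subsetP=> _ /imsetP[g _ ->]; apply: rhoA.
have [->|A0] := posnP #|A|; last by rewrite leq_pfact // inE; lia.
by move/(leq_trans (leq_fact n1)).
Qed.

Definition rep_stab y : {set 'S_n} := [set g | rho g y == y].

Lemma rep_stab_group_set y : group_set (rep_stab y).
Proof.
apply/group_setP; split=> [|g h]; rewrite !inE ?rho1 ?perm1 //.
by move=> /eqP gy /eqP hy; rewrite rhoM permM gy hy.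
Qed.

Canonical rep_stab_group y := Group (rep_stab_group_set y).

Lemma index_rep_stab y : y \in A ->
  #|[set: 'S_n] : rep_stab y| <= #|A|.
Proof.
move=> Ay.
have to1 : (fun z g => rho g z)^~ 1 =1 id by move=> z; rewrite rho1 perm1.
have toM z : act_morph (fun z g => rho g z) z by move=> g h; rewrite rhoM permM.
pose to := TotalAction to1 toM.
have -> : rep_stab y = 'C_[set: 'S_n][y | to].
  by apply/setP=> g; rewrite !inE sub1set inE.
rewrite -card_orbit; apply/subset_leq_card/subsetP=> _ /imsetP[g _ ->] /=.
by rewrite (perm_closed _ (rhoA g)).
Qed.

(** Sending [y h] to [i h] is a well-defined equivariant map from the orbit of [y] to ['I_n], and
    [f j] is a preimage of [j]. A preimage of a moved point is moved. *)
Lemma leq_card_moved_stab y (i : 'I_n) g :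
  (forall h, rho h y = y -> h i = i) -> #|moved g| <= #|moved (rho g)|.
Proof.
move=> fixi; pose f j := rho (tperm i j) y.
have stab a b : rho a y = rho b y -> (a * b^-1) i = i.
  by move=> e; apply: fixi; rewrite rhoM permM e rhoV permK.
have injf : injective f.
  move=> j k /stab; rewrite permM tpermV tpermL => e.
  by rewrite -[j](tpermK i k) e tpermL.
rewrite -(card_imset _ injf); apply/subset_leq_card/subsetP=> _ /imsetP[j + ->].
rewrite !inE; apply: contraNneq; rewrite /f -permM -rhoM => /stab.
by rewrite tpermV !permM tpermL => e; rewrite -[g j](tpermK i j) e tpermL.
Qed.

Lemma leq_card_moved_large g :
  7 <= n -> #|A| < 2 * n -> #|moved g| <= #|moved (rho g)|.
Proof.
move=> n7 ltA.
(* Taking [y] moved by a 3-cycle rules out a stabiliser containing all 3-cycles. *)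
have [y Ay [i fi]] : exists2 y, y \in A & exists i : 'I_n,
    forall h, h \in rep_stab y -> h i = i.
  have [c0 c1 c2] : [/\ 0 < n, 1 < n & 2 < n] by split; lia.
  pose c := cyc3 (Ordinal c0) (Ordinal c1) (Ordinal c2).
  have c_neq1 : c != 1.
    by apply/eqP=> /permP/(_ (Ordinal c0)); rewrite perm1 cyc3E // eqxx.
  have /existsP[y cy] : [exists y, rho c y != y].
    apply: contraNT c_neq1; rewrite negb_exists => /forallP cfix.
    apply/eqP/rhoI/permP=> z; rewrite rho1 perm1; apply/eqP.
    by have := cfix z; rewrite negbK.
  have Ay : y \in A by apply: contraNT cy => /(out_perm (rhoA c)) ->.
  exists y; first by [].
  have [||/(_ _ _ _ (_ : uniq [:: Ordinal c0; Ordinal c1; Ordinal c2]))|//] :=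
      @small_index_stab _ (rep_stab_group y).
  - by rewrite card_ord.
  - by rewrite card_ord; apply: leq_ltn_trans ltA; apply: index_rep_stab.
  - by move/(_ isT); rewrite inE (negPf cy).
by apply: (@leq_card_moved_stab y i) => h hy; apply: fi; rewrite inE hy.
Qed.

End FaithfulAction.

(** * Cycle lengths *)

Section CycleLengths.

Variable T : finType.
Implicit Types (s : {perm T}) (x : T).

(** Trivial cycles are left out, so that the entries add up to the number of moved points. Equal
    lengths are repeated, once per cycle. *)
Definition cycle_lengths s : seq nat :=
  [seq #|X| | X : {set T} in [set X in porbits s | 1 < #|X|]].

Lemma partition_porbits s : partition (porbits s) [set: T].
Proof.
have -> : porbits s = orbit 'P <[s]> @: [set: T].
  by rewrite -porbitE; apply/setP=> X; apply/imsetP/imsetP=> -[x _ ->]; exists x.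
by apply: orbit_partition; apply/actsP=> g _ x; rewrite !inE.
Qed.

Lemma porbit_gt1 s x : (1 < #|porbit s x|) = (s x != x).
Proof.
have := iter_porbit s x; have := uniq_traject_porbit s x.
have := card_porbit_neq0 s x.
case: #|_| => [|[|m]] //= _; first by move=> _ ->; rewrite eqxx.
by rewrite !inE negb_or eq_sym => /andP[/andP[-> _]].
Qed.

Lemma dvd_porbit s k x : (#|porbit s x| %| k) = ((s ^+ k) x == x).
Proof.
have itq q : iter (q * #|porbit s x|) s x = x.
  by elim: q => // q IH; rewrite mulSn iterD IH iter_porbit.
rewrite permX {2}(divn_eq k #|porbit s x|) addnC iterD itq /dvdn.
have := uniq_traject_porbit s x; set r := k %% _.
have : r < #|porbit s x| by rewrite ltn_mod lt0n card_porbit_neq0.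
case: #|_| => // m ltr U; have := @nth_uniq _ x _ r 0 _ _ U.
by rewrite size_traject !nth_traject // => ->.
Qed.

Lemma cycle_lengths_gt1 s : all (leq 2) (cycle_lengths s).
Proof. by apply/allP=> _ /imageP[X + ->]; rewrite inE => /andP[]. Qed.

Lemma sum_cycle_lengths s :
  sumn (cycle_lengths s) = \sum_(X in porbits s | 1 < #|X|) #|X|.
Proof.
by rewrite sumnE big_map big_enum; apply: eq_bigl => X; rewrite inE.
Qed.

Lemma sumn_cycle_lengths s : sumn (cycle_lengths s) = #|moved s|.
Proof.
have /and3P[_ trP _] := partition_porbits s.
rewrite sum_cycle_lengths (@card_partition _ [set X in porbits s | 1 < #|X|]).
  by apply: eq_bigl => X; rewrite inE.
apply/and3P; split.
- apply/eqP/setP=> x; rewrite inE -porbit_gt1; apply/bigcupP/idP=> [[X]|xs].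
    rewrite inE => /andP[/imsetP[y _ ->] y1] xy.
    by move: y1; rewrite -eq_porbit_mem in xy; rewrite (eqP xy).
  by exists (porbit s x); rewrite ?porbit_id // inE imset_f.
- by apply: trivIsetS trP; apply/subsetP=> X; rewrite inE => /andP[].
- by rewrite inE cards0 andbF.
Qed.

(** The sign is the parity of the number of points plus the number of cycles, and a fixed point adds
    one to both. *)
Lemma odd_cycle_lengths s :
  odd_perm s = odd (sumn (cycle_lengths s)) (+) odd (size (cycle_lengths s)).
Proof.
rewrite /odd_perm -cardsT (card_partition (partition_porbits s)).
rewrite sum_cycle_lengths (bigID (fun X : {set T} => 1 < #|X|)) /=.
rewrite size_map -cardE -(cardsID [set X : {set T} | 1 < #|X|] (porbits s)).
rewrite [X in odd (_ + X) (+) _](eq_bigr (fun=> 1%N)); last first.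
  move=> _ /andP[/imsetP[x _ ->]]; have := card_porbit_neq0 s x; lia.
rewrite sum1_card !oddD setIdE.
set a := odd _; set b := odd #|[pred _ | _]|; set c := odd _.
have -> : b = odd #|porbits s :\: [set X : {set T} | 1 < #|X|]|.
  by congr odd; apply: eq_card => X; rewrite !inE andbC.
by case: a; case: c; case: (odd _).
Qed.

Lemma dvd_cycle_lengths s k : all (dvdn^~ k) (cycle_lengths s) = (s ^+ k == 1).
Proof.
apply/allP/eqP=> [dv|sk _ /imageP[X + ->]]; last first.
  rewrite inE => /andP[/imsetP[x _ ->] _].
  by rewrite dvd_porbit sk perm1.
apply/permP=> x; rewrite perm1; apply/eqP; rewrite -dvd_porbit.
have [x1|] := leqP #|porbit s x| 1.
  suff -> : #|porbit s x| = 1%N by rewrite dvd1n.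
  by have := card_porbit_neq0 s x; lia.
move=> x1; apply: dv; apply/imageP; exists (porbit s x) => //.
by rewrite inE imset_f.
Qed.

Lemma dvd_lcm_cycle_lengths s k :
  (foldr lcmn 1%N (cycle_lengths s) %| k) = (s ^+ k == 1).
Proof.
rewrite -dvd_cycle_lengths; elim: (cycle_lengths s) => [|a l IH] /=.
  by rewrite dvd1n.
by rewrite dvdn_lcm IH.
Qed.

End CycleLengths.

(** * Cycle types of a permutation and of its image under an action *)

Section SmallDegree.

Variables (n : nat) (T : finType) (rho : 'S_n -> {perm T}).
Hypotheses (rhoM : {morph rho : g h / g * h}) (rhoI : injective rho).

(** The parity of [rho g] is a homomorphism to the group of order two. Transpositions being
    conjugate, it is either trivial or the sign. *)
Lemma odd_rho g : odd_perm (rho g) -> odd_perm g.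
Proof.
pose c h := odd_perm (rho h).
have cM h k : c (h * k) = c h (+) c k by rewrite /c rhoM odd_permM.
have c1 : c 1 = false by have := cM 1 1; rewrite mul1g; case: (c 1).
have cJ h k : c (h ^ k) = c h.
  have := cM k (h ^ k); rewrite -conjgC cM.
  by case: (c h); case: (c k); case: (c _).
have ctp i j k l : i != j -> k != l -> c (tperm i j) = c (tperm k l).
  move=> ij kl; pose t := tperm i k.
  have tj : k != t j by rewrite -(tpermL i k) (inj_eq perm_inj).
  rewrite -(cJ (tperm i j) (t * tperm (t j) l)) tpermJ !permM tpermL.
  by rewrite tpermL (tpermD (x := t j)) // eq_sym.
have [ts -> dts] := prod_tpermP g; rewrite odd_perm_prod // -/(c _).
case: ts dts => [|t0 ts] dts; first by rewrite big_nil c1.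
have -> : c (\prod_(t <- t0 :: ts) tperm t.1 t.2) =
          odd (size (t0 :: ts)) && c (tperm t0.1 t0.2).
  have /andP[d0 _] := dts.
  elim: (t0 :: ts) dts => [|t us IH] /=; first by rewrite big_nil c1.
  case/andP=> dt /IH; rewrite big_cons cM => ->.
  by rewrite (ctp _ _ _ _ dt d0); case: (odd _); case: (c _).
by case/andP.
Qed.

Lemma lcm_cycle_lengths_rho g :
  foldr lcmn 1%N (cycle_lengths (rho g)) = foldr lcmn 1%N (cycle_lengths g).
Proof.
have dvr k : (foldr lcmn 1%N (cycle_lengths (rho g)) %| k) =
             (foldr lcmn 1%N (cycle_lengths g) %| k).
  by rewrite !dvd_lcm_cycle_lengths -(rhoX rhoM) -(rho1 rhoM) (inj_eq rhoI).
by apply/eqP; rewrite eqn_dvd dvr dvdnn -dvr dvdnn.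
Qed.

End SmallDegree.

(** Ordered lists, since cycle lengths come in no particular order. The recursion drops by one only,
    although heads are at least 2, so the filter removes the excess. *)
Fixpoint compositions_upto (m : nat) : seq (seq nat) :=
  if m is m'.+1 then
    [::] :: [seq l <- [seq k :: l | k <- iota 2 m', l <- compositions_upto m'] |
             sumn l <= m]
  else [:: [::]].

Lemma mem_compositions_upto m l :
  all (leq 2) l -> sumn l <= m -> l \in compositions_upto m.
Proof.
elim: m l => [|m IH] [|k l] //= /andP[k2 l2] klm; first by lia.
rewrite inE /= mem_filter /= klm; apply/allpairsP; exists (k, l).
by split=> //=; [rewrite mem_iota; lia | apply: IH => //; lia].
Qed.

(** Exhaustive check on cycle types of equal order. Parity is what excludes pairs such as
    [[:: 2; 2]] with [[:: 2]], or [[:: 4; 2]] with [[:: 4]]. *)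
Lemma cycle_lengths_exception (l l' : seq nat) :
    all (leq 2) l -> all (leq 2) l' -> sumn l <= 6 -> sumn l' < sumn l ->
    foldr lcmn 1%N l' = foldr lcmn 1%N l ->
    (odd (sumn l') (+) odd (size l') -> odd (sumn l) (+) odd (size l)) ->
  (sumn l == 6) && [|| all (pred1 6) l, all (pred1 3) l | all (pred1 2) l].
Proof.
move=> l2 l2' l6 ltl e o.
have ml := mem_compositions_upto l2 l6.
have ml' : l' \in compositions_upto 5 by apply: mem_compositions_upto => //; lia.
have : all (fun l => all (fun l' => [&& sumn l' < sumn l,
    foldr lcmn 1%N l' == foldr lcmn 1%N l &
    odd (sumn l') (+) odd (size l') ==> odd (sumn l) (+) odd (size l)] ==>
  (sumn l == 6) && [|| all (pred1 6) l, all (pred1 3) l | all (pred1 2) l])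
  (compositions_upto 5)) (compositions_upto 6) by vm_compute.
move/allP/(_ l ml)/allP/(_ l' ml')/implyP; apply.
by rewrite ltl e eqxx; apply/implyP.
Qed.

(** * Actions of the Rees matrix semigroup *)

Lemma faithful_total_partial (S : Type) (mul : S -> S -> S) m :
  faithful_total mul m -> faithful_partial mul m.
Proof.
case=> phi [injphi phiM]; exists (fun x => [ffun z => Some (phi x z)]).
split=> [x y /ffunP e|x y].
  by apply: injphi; apply/ffunP=> z; have := e z; rewrite !ffunE => -[].
by apply/ffunP=> z; rewrite !ffunE /= ffunE phiM ffunE.
Qed.

Lemma faithful_total_finType (S : Type) (mul : S -> S -> S) (X : finType)
    (phi : S -> X -> X) :
  (forall x y, phi x =1 phi y -> x = y) ->
  (forall x y z, phi (mul x y) z = phi y (phi x z)) ->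
  faithful_total mul #|X|.
Proof.
move=> injphi phiM.
exists (fun x => [ffun i => enum_rank (phi x (enum_val i))]).
split=> [x y /ffunP e|x y].
  apply: injphi => z; apply: enum_rank_inj.
  by have := e (enum_rank z); rewrite !ffunE enum_rankK.
by apply/ffunP=> i; rewrite !ffunE enum_rankK phiM.
Qed.

Section ReesAction.

Variables (n : nat) (sigma : 'S_n) (T : finType) (rho : 'S_n -> {perm T}).
Hypotheses (rhoM : {morph rho : g h / g * h}) (rhoI : injective rho).
Hypothesis sigma_neq1 : sigma != 1.

Let X : finType := (T + {y | y \in moved (rho sigma)})%type.

Definition rees_inj (b : 'I_2) (y : T) : X :=
  if b == ord0 then inl y else if insub y is Some u then inr u else inl y.

Definition rees_proj (a : 'I_2) (x : X) : T :=
  match x with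
  | inl y => y
  | inr u => if a == ord0 then val u else rho sigma (val u)
  end.

(** [(a, g, b)] will act by projecting along [a], applying [rho g] and lifting along [b]. In a
    product the lift of one factor meets the projection of the next, so this identity is the
    multiplication rule. Points fixed by [sigma] need no second copy, since on them the entry
    [sigma] does nothing. *)
Lemma rees_injK b a y :
  rees_proj a (rees_inj b y) = rho (sandwich sigma b a) y.
Proof.
have I2 (c : 'I_2) : (c == ord_max) = (c != ord0) by case: c => [[|[]]].
rewrite /rees_inj /sandwich !I2; have [_|_] /= := eqVneq b ord0.
  by rewrite (rho1 rhoM) perm1.
case: insubP => [u _ <-|] /=.
  by case: (a == ord0); rewrite //= (rho1 rhoM) perm1.
rewrite inE negbK => /eqP sy.
by case: (a == ord0); rewrite /= ?(rho1 rhoM) ?perm1 ?sy.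
Qed.

Lemma faithful_total_rees :
  faithful_total (rees_mul sigma) (#|T| + #|moved (rho sigma)|).
Proof.
have <- : #|X| = (#|T| + #|moved (rho sigma)|)%N.
  by rewrite card_sum card_sig; congr (_ + _)%N; apply: eq_card => y; rewrite inE.
have [y0 y0s] : exists y0, y0 \in moved (rho sigma).
  apply/set0Pn; apply: contra_neq sigma_neq1 => /setP s0.
  apply/rhoI/permP=> y; rewrite (rho1 rhoM) perm1.
  by have := s0 y; rewrite !inE => /negPn/eqP.
pose phi (x : rees_T n) z :=
  let: (a, g, b) := x in rees_inj b (rho g (rees_proj a z)).
apply: (faithful_total_finType (phi := phi)) => [x y e|x y z]; last first.
  case: x y => [[a g] b] [[a' g'] b'].
  by rewrite /phi /= rees_injK !rhoM !permM.
case: x y e => [[a g] b] [[a' g'] b'] e.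
have I2 (c d : 'I_2) : (c == ord0) = (d == ord0) -> c = d.
  by case: c d => [[|[]] //= ?] [[|[]] //= ?] _; apply: val_inj.
(* Values equal to a lift of the moved point [y0] reveal [b] by the copy they lie in. *)
have eb : b = b'.
  have := e (inl ((rho g')^-1 y0)); have := e (inl ((rho g)^-1 y0)).
  rewrite /phi /= !permKV /rees_inj insubT /= => e1 e2; apply: I2.
  by move: e1 e2; case: (b == _); case: (b' == _) => //; case: insubP.
subst b'.
have eg : g = g'.
  apply/rhoI/permP=> y; have := congr1 (rees_proj ord0) (e (inl y)).
  by rewrite /phi /= !rees_injK /sandwich andbF (rho1 rhoM) !perm1.
subst g'; congr (_, _, _); apply: I2.
(* The second copy of [y0] separates the two projections, because [sigma] moves [y0]. *)
have := congr1 (rees_proj ord0) (e (inr (Sub y0 y0s))).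
rewrite /phi /= !rees_injK /sandwich andbF (rho1 rhoM) !perm1 => /perm_inj.
move: y0s; rewrite inE; case: (a == _); case: (a' == _) => //= /eqP ny.
  by move/esym.
by [].
Qed.

End ReesAction.

Lemma perm_rep_of_faithful_partial n (sigma : 'S_n) m :
  faithful_partial (rees_mul sigma) m ->
  exists (rho : 'S_n -> {perm 'I_m}) (A : {set 'I_m}),
    [/\ {morph rho : g h / g * h}, injective rho,
        forall g, perm_on A (rho g) & #|A| + #|moved (rho sigma)| <= m].
Proof.
case=> phi [injphi phiM].
have phiE x y z : phi (rees_mul sigma x y) z = obind (phi y) (phi x z).
  by rewrite phiM ffunE.
pose ps g := phi (ord0, g, ord0).
have psM g h x : ps (g * h) x = obind (ps h) (ps g x).
  by rewrite -phiE /= /sandwich mulg1.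
pose A := [set x | ps 1 x == Some x].
have psA g w x : ps g w = Some x -> x \in A.
  by move=> gw; have := psM g 1 w; rewrite mulg1 gw inE /= => <-.
(* On [A], the image of the idempotent [(1, 1, 1)], every [ps g] is defined, so the default of
   [odflt] is never taken; the identity off [A] makes [f g] a permutation of ['I_m]. *)
pose f g x := if x \in A then odflt x (ps g x) else x.
have fE g x : x \in A -> ps g x = Some (f g x).
  move=> Ax; have := psM g g^-1 x; rewrite mulgV /f Ax.
  by move: Ax; rewrite inE => /eqP->; case: (ps g x).
have fA g x : x \in A -> f g x \in A by move=> Ax; apply: psA (fE g x Ax).
have f1 x : f 1 x = x by rewrite /f inE; case: eqP => // ->.
have fM g h x : f (g * h) x = f h (f g x).
  have [Ax|nAx] := boolP (x \in A); last by rewrite /f !(negPf nAx).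
  by apply: Some_inj; rewrite -!fE ?fA // psM (fE g).
have injf g : injective (f g).
  by apply: (can_inj (g := f g^-1)) => x; rewrite -fM mulgV f1.
pose rho g := perm (@injf g).
have rhoE g x : rho g x = f g x by rewrite permE.
have sA g : perm_on A (rho g).
  by apply/subsetP=> x; rewrite inE rhoE; apply: contraNT => /negPf nAx; rewrite /f nAx.
exists rho, A; split=> // [g h|g h e|].
- by apply/permP=> x; rewrite permM !rhoE fM.
- suff : ps g = ps h by move/injphi => -[].
  (* [ps 1] lands in [A], so [ps g] is determined by its restriction to [A]. *)
  apply/ffunP=> w; rewrite -[g]mul1g -[h]mul1g !psM.
  case ew: (ps 1 w) => [x|] //=; have Ax := psA _ _ _ ew.
  by rewrite !fE // -!rhoE e.
(* [q] is the action of [(1, 1, 2)]. As [(1, 1, 2)(1, 1, 1) = (1, 1, 1)], it is defined on [A] and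
   undone there by [ps 1]. *)
pose q := phi (ord0, 1, ord_max); pose k x := odflt x (q x).
have ps1q x : ps 1 x = obind (ps 1) (q x).
  by rewrite -phiE /= /sandwich /= ?andbF !mulg1.
have qk x : x \in A -> q x = Some (k x).
  by rewrite inE ps1q /k; case: (q x).
have kK x : x \in A -> ps 1 (k x) = Some x.
  by move=> Ax; have := ps1q x; rewrite qk //= => <-; rewrite fE // f1.
have mA : moved (rho sigma) \subset A.
  by have := sA sigma; apply: subset_trans; apply/subsetP=> x; rewrite !inE.
have kA x : x \in moved (rho sigma) -> k x \notin A.
  (* If [k x] lay in [A], [q] would fix [x]. Now [(1, 1, 1)(2, 1, 1) = (1, 1, 1)] makes [p] fix [x],
     and then [(1, 1, 2)(2, 1, 1) = (1, sigma, 1)] makes [rho sigma] fix [x]. *)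
  move=> mx; have Ax := subsetP mA _ mx; apply: contraL mx => Akx.
  have kx : k x = x by move: Akx; rewrite inE kK // => /eqP[].
  pose p := phi (ord_max, 1, ord0).
  have px : ps 1 x = obind p (ps 1 x) by rewrite -phiE /= /sandwich /= ?andbF !mulg1.
  have spx : ps sigma x = obind p (q x).
    by rewrite -phiE /= /sandwich eqxx /= mul1g mulg1.
  move: px spx; rewrite qk // kx (fE 1 x) // f1 /= => <-.
  by rewrite (fE sigma) // inE rhoE => -[->]; rewrite eqxx.
have -> : #|moved (rho sigma)| = #|k @: moved (rho sigma)|.
  rewrite card_in_imset // => x y /(subsetP mA) Ax /(subsetP mA) Ay e.
  by apply: Some_inj; rewrite -!kK // e.
rewrite -cardsUI (_ : A :&: _ = set0) ?cards0 ?addn0.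
  by rewrite -[X in _ <= X]card_ord max_card.
apply/setP=> z; rewrite !inE; apply/andP=> -[Az /imsetP[x /kA + ez]].
by rewrite -ez inE Az.
Qed.

(** * The exotic action of S_6 *)

Definition relabellings : seq (seq nat) := Eval compute in permutations (iota 0 3).

(* The six one-factorizations of K_6 (synthematic totals) realise the outer
   automorphism of S_6.  On the vertices Z/5 and the extra point 5, one of them
   gives the edge ab the colour a + b and the edge a5 the colour 2a mod 5; the
   others are obtained by relabelling the vertices 0, 1, 2. *)
Definition colour (t a b : nat) : nat :=
  (* The default [k] makes the relabelling fix 3, 4 and 5. *)
  let r k := nth k (nth [::] relabellings t) k in
  let a' := r a in let b' := r b in
  (if a' == 5 then 2 * b' else if b' == 5 then 2 * a' else a' + b')%N %% 5.

Definition colour_table : seq (seq (seq nat)) :=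
  [seq [seq [seq colour t a b | b <- iota 0 6] | a <- iota 0 6] | t <- iota 0 6].

Definition tcolour (t : nat) (e : nat * nat) : nat :=
  nth 0 (nth [::] (nth [::] colour_table t) e.1) e.2.

Definition edges : seq (nat * nat) :=
  [seq e <- [seq (a, b) | a <- iota 0 6, b <- iota 0 6] | e.1 != e.2].

(** A one-factorization is a partition of the edges. Recording the pairs of edges of equal colour
    frees it from the names of the colours. *)
Definition monochrome (t : nat) : seq ((nat * nat) * (nat * nat)) :=
  [seq ef <- [seq (e, f) | e <- edges, f <- edges] |
   tcolour t ef.1 == tcolour t ef.2].

Definition monochrome_table := [seq monochrome t | t <- iota 0 6].

Definition map_edge (p : nat -> nat) (e : nat * nat) := (p e.1, p e.2).

(* Written with find rather than all, since find stops at the first failure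
   under vm_compute. *)
Definition carries (p : nat -> nat) (t t' : nat) : bool :=
  let s := nth [::] monochrome_table t in
  find (fun ef => tcolour t' (map_edge p ef.1) != tcolour t' (map_edge p ef.2)) s
    == size s.

Definition moved_totals (p : nat -> nat) : nat :=
  count (fun t => ~~ carries p t t) (iota 0 6).

Definition fixfree (p : nat -> nat) (j : nat) : bool :=
  all (fun k => iter j p k != k) (iota 0 6).

Definition iter_id (p : nat -> nat) (j : nat) : bool :=
  all (fun k => iter j p k == k) (iota 0 6).

(** The clauses give, in turn, an action on the totals, its faithfulness, and the effect on three
    cycle types: a 6-cycle moves five totals, two 3-cycles move three, three 2-cycles move two.
    Having no cycle of length 1, 2 or 3 characterises the 6-cycles. *)
Definition totals_spec (p : nat -> nat) : bool :=
  [&& all (fun t => count (carries p t) (iota 0 6) == 1%N) (iota 0 6),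
      (moved_totals p == 0) ==> iter_id p 1,
      [&& fixfree p 1, fixfree p 2 & fixfree p 3] ==> (moved_totals p == 5),
      fixfree p 1 && iter_id p 3 ==> (moved_totals p == 3) &
      fixfree p 1 && iter_id p 2 ==> (moved_totals p == 2)].

Lemma totals_spec_permutations :
  all (fun l => totals_spec (nth 0 l)) (permutations (iota 0 6)).
Proof. by vm_compute. Qed.

Lemma count_iota_ord m (P : pred nat) :
  count P (iota 0 m) = #|[set i : 'I_m | P i]|.
Proof.
by rewrite -sum1_card -sum1_count -val_enum_ord big_map big_enum_cond;
   apply: eq_bigl => i; rewrite inE.
Qed.

Definition perm_nat (g : 'S_6) : nat -> nat :=
  nth 0 [seq val (g i) | i <- enum 'I_6].

Lemma perm_natE (g : 'S_6) (i : 'I_6) : perm_nat g i = g i.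
Proof.
by rewrite /perm_nat (nth_map i) ?nth_ord_enum // size_enum_ord.
Qed.

Lemma iter_perm_nat (g : 'S_6) j (i : 'I_6) :
  iter j (perm_nat g) i = (g ^+ j) i.
Proof. by rewrite permX; elim: j => //= j ->; rewrite perm_natE. Qed.

Lemma totals_spec_perm_nat (g : 'S_6) : totals_spec (perm_nat g).
Proof.
have /allP := totals_spec_permutations; apply.
rewrite mem_permutations -val_enum_ord map_comp; apply: perm_map.
apply: uniq_perm; rewrite ?(map_inj_uniq perm_inj) ?enum_uniq // => i.
by rewrite mem_enum; apply/mapP; exists (g^-1 i); rewrite ?mem_enum ?permKV.
Qed.

Lemma mem_edges (a b : nat) : (a, b) \in edges = [&& a < 6, b < 6 & a != b].
Proof.
rewrite andbA [RHS]andbC mem_filter; congr (_ && _).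
apply/allpairsP/andP=> [[[c d] [+ + [-> ->]]]|[a6 b6]].
  by rewrite !mem_iota => /andP[_ ?] /andP[_ ?].
by exists (a, b); rewrite !mem_iota; split.
Qed.

Lemma carriesP (g : 'S_6) (t t' : 'I_6) :
  reflect (forall a b c d : 'I_6, a != b -> c != d ->
             tcolour t (a : nat, b : nat) = tcolour t (c : nat, d : nat) ->
             tcolour t' (g a : nat, g b : nat) = tcolour t' (g c : nat, g d : nat))
          (carries (perm_nat g) t t').
Proof.
rewrite /carries (nth_map 0) ?size_iota ?nth_iota // add0n.
set P := (X in find X _); set s := monochrome t.
have -> : (find P s == size s) = ~~ has P s.
  by rewrite has_find -leqNgt eqn_leq find_size.
apply: (iffP hasPn) => [H a b c d ab cd e|H [[a b] [c d]]].
  have := H ((a : nat, b : nat), (c : nat, d : nat)).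
  rewrite /P /map_edge /= !perm_natE negbK => H'; apply/eqP/H'.
  rewrite mem_filter; apply/andP; split; first exact/eqP.
  apply/allpairsP.
  exists ((a : nat, b : nat), (c : nat, d : nat)); split=> //=.
    by rewrite mem_edges !ltn_ord.
  by rewrite mem_edges !ltn_ord.
rewrite mem_filter => /andP[/eqP e /allpairsP[[e1 e2] /= [+ + [E1 E2]]]].
rewrite -{}E1 -{}E2 !mem_edges => /and3P[a6 b6 ab] /and3P[c6 d6 cd].
rewrite /P /map_edge /= negbK.
have := H (Ordinal a6) (Ordinal b6) (Ordinal c6) (Ordinal d6) ab cd e.
by rewrite -!perm_natE => ->.
Qed.

Lemma dvd_all_cycles_of_length n (g : 'S_n) k j (i : 'I_n) :
  all_cycles_of_length g k -> (k %| j) = ((g ^+ j) i == i).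
Proof.
move/forall_inP/(_ (porbit g i)) => /(_ (imset_f _ _))/eqP <- //.
by rewrite dvd_porbit.
Qed.

Lemma outer_S6_action : exists rho : 'S_6 -> {perm 'I_6},
  [/\ {morph rho : g h / g * h}, injective rho,
      forall g, all_cycles_of_length g 6 -> #|moved (rho g)| = 5,
      forall g, all_cycles_of_length g 3 -> #|moved (rho g)| = 3 &
      forall g, all_cycles_of_length g 2 -> #|moved (rho g)| = 2].
Proof.
pose C g t t' := carries (perm_nat g) (val (t : 'I_6)) (val (t' : 'I_6)).
have C1 g t : exists t', [set u | C g t u] = [set t'].
  have /and5P[/allP/(_ (val t)) + _ _ _ _] := totals_spec_perm_nat g.
  by rewrite mem_iota ltn_ord count_iota_ord => /(_ isT)/cards1P.
(* By [C1] there is exactly one candidate, so the default [t] is never taken. *)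
pose f g t := odflt t [pick u | C g t u].
have CP g t u : C g t u = (u == f g t).
  have [t' et] := C1 g t; rewrite /f.
  have memC v : C g t v = (v == t') by move/setP: et => /(_ v); rewrite !inE.
  by case: pickP => [v|/(_ t')]; rewrite !memC ?eqxx // => /eqP->.
have fM g h t : f (g * h) t = f h (f g t).
  apply/esym/eqP; rewrite -CP.
  have /carriesP Hg : C g t (f g t) by rewrite CP.
  have /carriesP Hh : C h (f g t) (f h (f g t)) by rewrite CP.
  apply/carriesP=> a b c d ab cd e; rewrite !permM.
  by apply: Hh; rewrite ?(inj_eq perm_inj) //; apply: Hg.
have f1 t : f 1 t = t.
  by apply/esym/eqP; rewrite -CP; apply/carriesP=> a b c d _ _; rewrite !perm1.
have injf g : injective (f g).
  by apply: (can_inj (g := f g^-1)) => t; rewrite -fM mulgV f1.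
pose rho g := perm (@injf g).
have movedE g : moved_totals (perm_nat g) = #|moved (rho g)|.
  rewrite /moved_totals count_iota_ord; apply: eq_card => t.
  by rewrite !inE permE -[carries _ _ _]/(C g t t) CP eq_sym.
have rhoM : {morph rho : g h / g * h}.
  by move=> g h; apply/permP=> t; rewrite permM !permE fM.
have ker g : rho g = 1 -> g = 1.
  have /and5P[_ /implyP + _ _ _] := totals_spec_perm_nat g.
  rewrite movedE => K r1; apply/permP=> i; rewrite perm1; apply/val_inj/eqP.
  have /allP/(_ (val i)) : iter_id (perm_nat g) 1.
    by apply: K; rewrite r1 cards_eq0; apply/eqP/setP=> t; rewrite !inE perm1 eqxx.
  by rewrite mem_iota ltn_ord => /(_ isT); rewrite /= perm_natE.
have cycF g k j : all_cycles_of_length g k -> ~~ (k %| j) -> fixfree (perm_nat g) j.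
  move=> gk kj; apply/allP=> i; rewrite mem_iota => /= i6.
  have := dvd_all_cycles_of_length j (Ordinal i6) gk.
  by rewrite -val_eqE /= -iter_perm_nat => <-.
have cycI g k : all_cycles_of_length g k -> iter_id (perm_nat g) k.
  move=> gk; apply/allP=> i; rewrite mem_iota => /= i6.
  have := dvd_all_cycles_of_length k (Ordinal i6) gk.
  by rewrite -val_eqE /= -iter_perm_nat => <-.
exists rho; split=> // [g h e|g gk|g gk|g gk].
- apply/eqP; rewrite eq_mulgV1; apply/eqP/ker.
  by rewrite rhoM e -rhoM mulgV; apply/permP=> t; rewrite permE f1 perm1.
- have /and5P[_ _ /implyP + _ _] := totals_spec_perm_nat g.
  by rewrite movedE => H; apply/eqP/H; rewrite !(cycF _ _ _ gk).
- have /and5P[_ _ _ /implyP + _] := totals_spec_perm_nat g.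
  by rewrite movedE => H; apply/eqP/H; rewrite (cycF _ _ _ gk) // cycI.
- have /and5P[_ _ _ _ /implyP] := totals_spec_perm_nat g.
  by rewrite movedE => H; apply/eqP/H; rewrite (cycF _ _ _ gk) // cycI.
Qed.

(** * Bounds on moved points and the minimal degrees *)

Lemma lcm_all_cycles_of_length n (g : 'S_n) k :
  0 < n -> all_cycles_of_length g k -> foldr lcmn 1%N (cycle_lengths g) = k.
Proof.
move=> n0 gk.
have gX j : (g ^+ j == 1) = (k %| j).
  apply/eqP/idP=> [gj|kj].
    by rewrite (dvd_all_cycles_of_length j (Ordinal n0) gk) gj perm1.
  apply/permP=> i; rewrite perm1; apply/eqP.
  by rewrite -(dvd_all_cycles_of_length j i gk).
by apply/eqP; rewrite eqn_dvd dvd_lcm_cycle_lengths gX dvdnn -gX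
   -dvd_lcm_cycle_lengths dvdnn.
Qed.

(** [w] is the least number of points moved by a permutation of order [k]; order 6 needs at least a
    2-cycle and a 3-cycle. A counterexample would have sum at most 4, which bounds the search. *)
Lemma leq_sumn_lcm k w l :
  (k, w) \in [:: (6, 5); (3, 3); (2, 2)] -> all (leq 2) l ->
  foldr lcmn 1%N l = k -> w <= sumn l.
Proof.
move=> kw l2 lk; rewrite leqNgt; apply/negP=> lw.
have ml : l \in compositions_upto 4.
  apply: mem_compositions_upto => //.
  by move: kw; rewrite !inE => /or3P[]/eqP[_ e]; move: lw; rewrite e; lia.
have : all (fun kw : nat * nat => all (fun l => (foldr lcmn 1%N l == kw.1) ==>
         (kw.2 <= sumn l)) (compositions_upto 4))
         [:: (6, 5); (3, 3); (2, 2)] by vm_compute.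
move/allP/(_ _ kw)/allP/(_ _ ml)/implyP => /=.
by rewrite lk => /(_ (eqxx _)); rewrite leqNgt lw.
Qed.

Lemma all_cycles_of_length_moved n (g : 'S_n) k :
  #|moved g| = n -> all (pred1 k) (cycle_lengths g) -> all_cycles_of_length g k.
Proof.
move=> gn /allP gk; apply/forall_inP=> _ /imsetP[x _ ->].
have mx : x \in moved g.
  suff -> : moved g = setT by rewrite inE.
  by apply/eqP; rewrite eqEcard subsetT cardsT card_ord gn leqnn.
apply: gk; apply/imageP; exists (porbit g x) => //.
by rewrite inE imset_f // porbit_gt1; move: mx; rewrite inE.
Qed.

Lemma leq_card_moved_small n (T : finType) (rho : 'S_n -> {perm T}) g :
  {morph rho : g h / g * h} -> injective rho -> n <= 6 ->
  ~~ ((n == 6) && [|| all_cycles_of_length g 6, all_cycles_of_length g 3 |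
                     all_cycles_of_length g 2]) ->
  #|moved g| <= #|moved (rho g)|.
Proof.
move=> rhoM rhoI n6; apply: contraNT; rewrite -ltnNge => lt.
have gn : #|moved g| <= n by rewrite -[X in _ <= X]card_ord max_card.
have := @cycle_lengths_exception (cycle_lengths g) (cycle_lengths (rho g)).
rewrite !cycle_lengths_gt1 !sumn_cycle_lengths lcm_cycle_lengths_rho //.
rewrite -!sumn_cycle_lengths -!odd_cycle_lengths !sumn_cycle_lengths.
case/(_ isT isT _ lt erefl (odd_rho rhoM (g := g)))/andP; first by lia.
move=> /eqP g6 ex; have n_eq6 : n = 6 by lia.
have gn' : #|moved g| = n by lia.
apply/andP; split; first exact/eqP.
by case/or3P: ex => /(all_cycles_of_length_moved gn') ->; rewrite ?orbT.
Qed.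

Lemma degree_moved n (g : 'S_n) : (2 * n - #|Fix g| = n + #|moved g|)%N.
Proof.
have := cardsC (Fix g); rewrite card_ord (_ : ~: Fix g = moved g); first by lia.
by apply/setP=> i; rewrite !inE.
Qed.

(** Total actions are partial actions, so an upper bound for the former and a lower bound for the
    latter settle both. *)
Lemma min_degrees (S : Type) (mul : S -> S -> S) d :
  faithful_total mul d -> (forall m, faithful_partial mul m -> d <= m) ->
  min_degree_partial mul d /\ min_degree_total mul d.
Proof.
move=> td le; split; split=> //; first exact: faithful_total_partial.
by move=> m /faithful_total_partial; apply: le.
Qed.

(** The exotic action attains the bound. Below it, six points are needed for faithfulness and [w]
    moved points for the order of [sigma]. *)
Lemma min_degrees_exceptional (sigma : 'S_6) k w :
  (k, w) \in [:: (6, 5); (3, 3); (2, 2)] -> all_cycles_of_length sigma k ->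
  min_degree_partial (rees_mul sigma) (6 + w) /\
  min_degree_total (rees_mul sigma) (6 + w).
Proof.
move=> kw sk.
have s1 : sigma != 1.
  apply: contraL kw => /eqP s1.
  have := dvd_all_cycles_of_length 1 ord0 sk.
  by rewrite s1 expg1 perm1 eqxx dvdn1 => /eqP->.
apply: min_degrees => [|m].
  have [rho [rhoM rhoI m6 m3 m2]] := outer_S6_action.
  have <- : #|moved (rho sigma)| = w.
    move: kw sk; rewrite !inE => /or3P[]/eqP[-> ->] sk.
    - exact: m6.
    - exact: m3.
    - exact: m2.
  by have := faithful_total_rees rhoM rhoI s1; rewrite card_ord.
case/perm_rep_of_faithful_partial=> rho [A [rhoM rhoI rhoA]]; apply: leq_trans.
apply: leq_add; first by apply: leq_degree_faithful rhoA _.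
rewrite -sumn_cycle_lengths; apply: leq_sumn_lcm kw (cycle_lengths_gt1 _) _.
by rewrite lcm_cycle_lengths_rho // (lcm_all_cycles_of_length _ sk).
Qed.

Theorem theorem2p18 (n : nat) (sigma : 'S_n) :
  2 <= n -> sigma != 1%g ->
  let S := rees_mul sigma in
  let exceptional :=
    (n == 6) && [|| all_cycles_of_length sigma 6,
                    all_cycles_of_length sigma 3 |
                    all_cycles_of_length sigma 2] in
  (~~ exceptional ->
     min_degree_partial S (2 * n - #|Fix sigma|) /\
     min_degree_total S (2 * n - #|Fix sigma|)) /\
  (n = 6 -> all_cycles_of_length sigma 6 ->
     min_degree_partial S 11 /\ min_degree_total S 11) /\
  (n = 6 -> all_cycles_of_length sigma 3 ->
     min_degree_partial S 9 /\ min_degree_total S 9) /\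
  (n = 6 -> all_cycles_of_length sigma 2 ->
     min_degree_partial S 8 /\ min_degree_total S 8).
Proof.
move=> n2 s1 S exceptional; rewrite /S {S}.
split=> [nex|]; last first.
  by split; last split; move=> n6 sk; subst n;
     apply: min_degrees_exceptional sk.
rewrite degree_moved; apply: min_degrees => [|m].
  (* The upper bound comes from the natural action of ['S_n]. *)
  have := @faithful_total_rees n sigma _ id (fun _ _ => erefl) (@inj_id _) s1.
  by rewrite card_ord.
case/perm_rep_of_faithful_partial=> rho [A [rhoM rhoI rhoA]]; apply: leq_trans.
have nA := leq_degree_faithful rhoI rhoA n2.
(* With [2 * n] points or more in [A] the bound is immediate, because [sigma] moves at most [n]
   points. *)
have [A2n|A2n] := leqP (2 * n) #|A|.
  have : #|moved sigma| <= n by rewrite -[X in _ <= X]card_ord max_card.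
  by lia.
apply: leq_add nA _; have [n6|n7] := leqP n 6.
  exact: leq_card_moved_small.
exact: leq_card_moved_large rhoA _ _ _.
Qed.
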